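(* Let $\Delta$ be a partition of $n$ of the form $(n_1^{p_1},\dots,n_k^{p_k})$ with $n_1<\dots<n_k\le p$, let $z\in M(d,n;\mathbb{F}_q)$ and let $\chi$ be a character of $H_\Delta$. Then: (i) for $g\in GL_d(\mathbb{F}_q)$, $N(X_{\Delta,z};\chi)=N(X_{\Delta,gz};\chi)$; (ii) for $h\in H_\Delta$, $\chi(h)N(X_{\Delta,z};\chi)=N(X_{\Delta,zh};\chi)$; (iii) for $w\in W_\Delta$, $N(X_{\Delta,z};\chi\,{}^tw)=N(X_{\Delta,zw};\chi)$.
   Context: $q$ is a power of a prime $p$, $N=q-1$, $\psi$ a fixed nontrivial additive character, $\psi_a(x)=\psi(ax)$. $\Delta=(n_1^{p_1},\dots)$ means $n_i$ repeated $p_i$ times; write the parts as $N_1\le\dots\le N_l$. For $m\ge1$ let $\Lambda$ be the $m\times m$ matrix with $1$'s on the superdiagonal, $[h_0,\dots,h_{m-1}]=\sum_ih_i\Lambda^i$, $J(m)=\{[h_0,\dots,h_{m-1}]:h_0\in\mathbb{F}_q^*,h_i\in\mathbb{F}_q\}$. For $x=(x_0,x_1,\dots)$, $X_j=x_j/x_0$, $\theta_i(x)=\sum_{k_1+2k_2+\dots+ik_i=i,\,k_j\ge0}(-1)^{k_1+\dots+k_i-1}\frac{(k_1+\dots+k_i-1)!}{k_1!\cdots k_i!}X_1^{k_1}\cdots X_i^{k_i}$, $\overline\theta_i(x)=x_0^i\theta_i(x)$, $\theta_i([h_0,\dots,h_{m-1}])=\theta_i(h_0,\dots,h_i)$. $H_\Delta=\{\mathrm{diag}(h_1,\dots,h_l):h_i\in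 J(N_i)\}$; $\widetilde\iota(\mathrm{diag}(h_i))=(h_{i,0},\theta_1(h_i),\dots,\theta_{N_i-1}(h_i))_i$ is an isomorphism onto $G_\Delta=\prod_i(\mathbb{F}_q^*\times\mathbb{F}_q^{N_i-1})$; characters of $J(m)$ are $(\alpha,a)\colon h\mapsto\alpha(h_0)\prod_{i}\psi(a_i\theta_i(h))$ ($\alpha$ a character of $\mathbb{F}_q^*$, $a\in\mathbb{F}_q^{m-1}$ a row vector), and characters of $H_\Delta$ are tuples of these with $\chi(h)=\prod\chi_i(h_i)$. Write $z=(z^{(1)},\dots,z^{(l)})$, $z^{(i)}=(z^{(i)}_0,\dots,z^{(i)}_{N_i-1})$ consecutive column blocks. $X_{\Delta,z}$: affine variety over $\mathbb{F}_q$ in coordinates $t_i$, $u_{(i,j)}$ ($1\le j\le N_i-1$), $s\in\mathbb{A}^d$, with $t_i^N=sz^{(i)}_0$, $t_i^{Nj}(u_{(i,j)}^q-u_{(i,j)})=\overline\theta_j(sz^{(i)})$, $t_i\ne0$. $G_\Delta$ acts by $(\xi_i,a_{(i,j)})\cdot(t_i,u_{(i,j)},s)=(\xi_it_i,u_{(i,j)}+a_{(i,j)},s)$, and $H_\Delta$ acts through $\widetilde\iota$. $N(X;\chi)=\frac1{\#G}\sum_{g\in G}\chi(g)\#\{P\in X(\overline{\mathbb{F}}_q):\mathrm{Frob}(P)=g\cdot P\}$ for a finite abelian group $G$ acting on $X$. $W_\Delta$: $\mu_{a,b}(y)=0$ if $a>b$, $\mu_{0,0}=1$, else $\mu_{a,b}(y)=\sum_{j_1,\dots,j_a\ge1,\,\sum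 j_r=b}y_{j_1}\cdots y_{j_a}$; $\mu(c)=(\mu_{a,b}(c))_{0\le a,b\le m-1}$, $\mu(c)'=(\mu_{a,b}(c))_{1\le a,b\le m-1}$, $W(m)=\{\mu(c):c\in\mathbb{F}_q^{m-1},c_1\ne0\}$; for $\sigma\in S_{p_i}$, $\widetilde P_\sigma$ is the block permutation matrix whose $j$-th block column has $I_{n_i}$ in block row $\sigma(j)$. $W_\Delta$ consists of $w=\mathrm{diag}(w_1,\dots,w_k)$ with $w_i=\mathrm{diag}(\mu(c_1),\dots,\mu(c_{p_i}))\widetilde P_{\sigma_i}$, $\mu(c_j)\in W(n_i)$. For a character $(\alpha,a)$ of $J(n_i)$ set $(\alpha,a)\,{}^t\mu(c)=(\alpha,a\,{}^t\mu(c)')$; writing $\chi=(\chi_1,\dots,\chi_k)$, $\chi_i=(\chi_{i,1},\dots,\chi_{i,p_i})$, set $\chi_i\,{}^tw_i=(\chi_{i,\sigma_i^{-1}(1)}{}^t\mu(c_1),\dots,\chi_{i,\sigma_i^{-1}(p_i)}{}^t\mu(c_{p_i}))$ and $\chi\,{}^tw=(\chi_i\,{}^tw_i)_i$. *)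

(* Defs.v *)
From HB Require Import structures.
From mathcomp Require Import all_boot all_order all_fingroup all_algebra.
From mathcomp Require Import finmap classical_sets cardinality.

Set Implicit Arguments.
Unset Strict Implicit.
Unset Printing Implicit Defensive.

Import GRing.Theory.
Local Open Scope ring_scope.

(* Coordinates of a row vector as a sequence x_0, x_1, ..., extended by 0. *)
Definition rcoef (R : nmodType) m (x : 'rV[R]_m) (j : nat) : R :=
  if insub j is Some j' then x 0 j' else 0.

Section Theta.
Variable R : fieldType.

(* k j stands for the exponent k_{j+1}; the constraint forces it to be <= i,
   so in characteristic p all factorials involved are units when i < p. *)
Definition theta (i : nat) (x : nat -> R) : R :=
  \sum_(k : {ffun 'I_i -> 'I_i.+1} | (\sum_(j < i) j.+1 * k j == i)%N)
    (-1) ^+ (\sum_(j < i) k j).-1%N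
    * ((\sum_(j < i) k j).-1`!)%N%:R / (\prod_(j < i) (k j)`!)%N%:R
    * \prod_(j < i) (x j.+1 / x 0%N) ^+ k j.

(* Only evaluated where x_0 != 0, so that it agrees with the polynomial. *)
Definition theta_bar (i : nat) (x : nat -> R) : R := x 0%N ^+ i * theta i x.

End Theta.

Section JordanGroup.
Variable F : finFieldType.

Definition Lambda m : 'M[F]_m := \matrix_(i, j) (j == i.+1 :> nat)%:R.

Definition jmx m (h : 'rV[F]_m) : 'M[F]_m :=
  \sum_(i < m) h 0 i *: Lambda m ^+ i.

Definition J m : {set 'M[F]_m} := [set jmx h | h : 'rV[F]_m & rcoef h 0 != 0].

(* The first row of [h_0, ..., h_{m-1}] is (h_0, ..., h_{m-1}). *)
Definition jcoef m (A : 'M[F]_m) (j : nat) : F :=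
  if insub 0%N is Some i0 then rcoef (row i0 A) j else 0.

End JordanGroup.

Section Mu.
Variable F : finFieldType.

(* The sum is empty when a > b or a = 0 < b, and it equals 1 for a = b = 0. *)
Definition mu_coef (a b : nat) (y : nat -> F) : F :=
  \sum_(j : {ffun 'I_a -> 'I_b.+1}
        | [forall r, 0 < j r]%N && (\sum_(r < a) j r == b)%N)
    \prod_(r < a) y (j r).

(* c = (c_1, ..., c_{m-1}) is stored with its index shifted by one. *)
Definition mu m (c : 'rV[F]_m.-1) : 'M[F]_m :=
  \matrix_(a, b) mu_coef a b (fun j => rcoef c j.-1).

Definition mu' m (c : 'rV[F]_m.-1) : 'M[F]_m.-1 :=
  \matrix_(a, b) mu_coef a.+1 b.+1 (fun j => rcoef c j.-1).

End Mu.

Section Characters.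
Variables (F : finFieldType) (C : numClosedFieldType).

Definition additive_character (psi : F -> C) : Prop :=
  psi 0 = 1 /\ forall x y, psi (x + y) = psi x * psi y.

(* The value at 0 is irrelevant. *)
Record mulchar := MulChar {
  mulchar_val :> F -> C;
  mulchar1 : mulchar_val 1 = 1;
  mulcharM : forall x y, x != 0 -> y != 0 ->
    mulchar_val (x * y) = mulchar_val x * mulchar_val y }.

Definition jchar m : Type := (mulchar * 'rV[F]_m.-1)%type.

Definition jchar_val (psi : F -> C) m (chi : jchar m) (h : 'M[F]_m) : C :=
  chi.1 (jcoef h 0)
  * \prod_(i < m.-1) psi (chi.2 0 i * theta i.+1 (jcoef h)).

Definition jchar_tmu m (chi : jchar m) (c : 'rV[F]_m.-1) : jchar m :=
  (chi.1, chi.2 *m (mu' c)^T).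

End Characters.

(* N(X; chi) for a group G acting on the points of X. *)
Definition twisted_count (C : numClosedFieldType) (T : choiceType)
    (X : set T) (frob : T -> T) (gT : finType) (G : {set gT})
    (act : gT -> T -> T) (chi : gT -> C) : C :=
  #|G|%:R^-1 *
  \sum_(g in G)
    chi g * (#|` fset_set [set P | X P /\ frob P = act g P]%classic|)%:R.

Section Delta.
(* The partition (n_1^{p_1}, ..., n_k^{p_k}) with n_i = ns i and p_i = ps i;
   its parts are indexed by the pairs (i, j) with i < k and j < ps i. *)
Variables (F : finFieldType) (k : nat) (ns ps : 'I_k -> nat).

Definition psum : nat := (\sum_(i < k) \sum_(j < ps i) ns i)%N.

Definition part_index : finType := {i : 'I_k & 'I_(ps i)}.
Definition part_size (b : part_index) : nat := ns (tag b).

(* The pair (b, j) stands for the index (b, j + 1) of u. *)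
Definition u_index : finType := {b : part_index & 'I_(part_size b).-1}.

Definition zblock d (z : 'M[F]_(d, psum)) (b : part_index) :
    'M[F]_(d, part_size b) :=
  @submxrow _ _ (fun _ : 'I_(ps (tag b)) => ns (tag b)) _
    (@submxrow _ _ (fun i => \sum_(j < ps i) ns i)%N _ z (tag b)) (tagged b).

Definition diag_block (h : 'M[F]_psum) (b : part_index) : 'M[F]_(part_size b) :=
  let p := (fun i => \sum_(j < ps i) ns i)%N in
  let q := (fun _ : 'I_(ps (tag b)) => ns (tag b)) in
  @submxblock _ _ _ q q
    (@submxblock _ _ _ p p h (tag b) (tag b)) (tagged b) (tagged b).

Definition block_diag (B : forall b, 'M[F]_(part_size b)) : 'M[F]_psum :=
  \mxdiag_(i < k) \mxdiag_(j < ps i) B (Tagged (fun i => 'I_(ps i)) j).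

Definition H_Delta : {set 'M[F]_psum} :=
  [set h | (h == block_diag (diag_block h))
           && [forall b, diag_block h b \in J F (part_size b)]].

Definition G_elt : Type := ({ffun part_index -> F} * {ffun u_index -> F})%type.

Definition iota_tilde (h : 'M[F]_psum) : G_elt :=
  ([ffun b => jcoef (diag_block h b) 0],
   [ffun v : u_index => theta (tagged v).+1 (jcoef (diag_block h (tag v)))]).

Section Variety.
(* K is meant to be an algebraic closure of F, embedded by e. *)
Variables (K : closedFieldType) (e : {rmorphism F -> K}) (d : nat).

Definition point : choiceType :=
  ({ffun part_index -> K} * {ffun u_index -> K} * 'rV[K]_d)%type.

Definition X_Delta (z : 'M[F]_(d, psum)) : set point :=
  fun '(t, u, s) =>
    let sz b := rcoef (s *m map_mx e (zblock z b)) in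
    [/\ forall b, t b ^+ #|F|.-1 = sz b 0%N,
        forall v : u_index,
          t (tag v) ^+ (#|F|.-1 * (tagged v).+1) * (u v ^+ #|F| - u v)
            = theta_bar (tagged v).+1 (sz (tag v))
      & forall b, t b != 0].

Definition Frob (P : point) : point :=
  let '(t, u, s) := P in
  ([ffun b => t b ^+ #|F|], [ffun v => u v ^+ #|F|],
   map_mx (fun x => x ^+ #|F|) s).

Definition G_act (g : G_elt) (P : point) : point :=
  let '(t, u, s) := P in
  ([ffun b => e (g.1 b) * t b], [ffun v => u v + e (g.2 v)], s).

Definition H_act (h : 'M[F]_psum) (P : point) : point := G_act (iota_tilde h) P.

End Variety.

Section HCharacters.
Variables (C : numClosedFieldType) (psi : F -> C).

Definition Hchar : Type := forall b : part_index, jchar F C (part_size b).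

Definition Hchar_val (chi : Hchar) (h : 'M[F]_psum) : C :=
  \prod_b jchar_val psi (chi b) (diag_block h b).

Definition N_Delta (K : closedFieldType) (e : {rmorphism F -> K}) d
    (z : 'M[F]_(d, psum)) (chi : Hchar) : C :=
  twisted_count (X_Delta e z) (@Frob K d) H_Delta (H_act e (d := d))
    (Hchar_val chi).

End HCharacters.

(* An element w of W_Delta, given by the permutations sigma_i and the vectors
   c_j it is built from, which w determines. The condition c_1 != 0 is void for
   parts of size 1, so that W(1) is trivial. *)
Record W_Delta := WDelta {
  W_perm : forall i : 'I_k, 'S_(ps i);
  W_coef : forall b : part_index, 'rV[F]_(part_size b).-1;
  W_coef_neq0 : forall b, (1 < part_size b)%N -> rcoef (W_coef b) 0 != 0 }.

Definition perm_block i (s : 'S_(ps i)) : 'M[F]_(\sum_(j < ps i) ns i) :=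
  \mxblock_(a < ps i, b < ps i) (if a == s b then 1%:M else 0 : 'M[F]_(ns i)).

Definition W_mx (w : W_Delta) : 'M[F]_psum :=
  \mxdiag_(i < k)
    ((\mxdiag_(j < ps i) mu (W_coef w (Tagged (fun i => 'I_(ps i)) j)))
     *m perm_block (W_perm w i)).

(* The component (i, j) of chi ^t w is chi_{i, sigma_i^{-1}(j)} ^t mu(c_j). *)
Definition Hchar_tw (C : numClosedFieldType) (chi : Hchar C) (w : W_Delta) :
    Hchar C :=
  fun b =>
    jchar_tmu
      (chi (Tagged (fun i => 'I_(ps i)) ((W_perm w (tag b))^-1%g (tagged b)))
        : jchar F C (part_size b))
      (W_coef w b).

End Delta.

(* Main.v *)
Require Import Defs.
From mathcomp Require Import all_boot all_order all_fingroup all_algebra.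
From mathcomp Require Import all_field.
From mathcomp Require Import finmap boolp classical_sets cardinality.

(* On X_{Delta,z} the equation Frob P = h . P forces s to be rational and says
   that s z is the family of first rows of the blocks of h; the remaining
   coordinates (t, u) form a torsor under G_Delta.  Hence N(X_{Delta,z}; chi)
   is, up to a factor that depends neither on z nor on chi, the sum of chi(s z)
   over the s in F^d such that every s z^(i) has a nonzero first entry, and the
   three claims become statements about chi.  They hold because theta_i(x) is
   the i-th coefficient of the logarithm of sum_j (x_j / x_0) T^j truncated
   below degree p: J(m) acts on rows by multiplication of truncated series,
   which the logarithm turns into addition, and mu(c) acts by the substitution
   T -> sum_j c_j T^j, which commutes with the logarithm. *)

Set Implicit Arguments.
Unset Strict Implicit.
Unset Printing Implicit Defensive.

Import GRing.Theory.
Local Open Scope ring_scope.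

(** * Congruence of polynomials modulo a power of X *)

Section Congruence.
Variable F : fieldType.
Implicit Types p q U : {poly F}.

Definition eqmodX n p q := forall i, (i < n)%N -> p`_i = q`_i.

Lemma eqmodX_sym n p q : eqmodX n p q -> eqmodX n q p.
Proof. by move=> pq i /pq. Qed.

Lemma eqmodX_trans n p q r : eqmodX n p q -> eqmodX n q r -> eqmodX n p r.
Proof. by move=> pq qr i lt_in; rewrite pq ?qr. Qed.

Lemma eqmodX_leq m n p q : (m <= n)%N -> eqmodX n p q -> eqmodX m p q.
Proof. by move=> le_mn pq i lt_im; apply: pq; apply: leq_trans le_mn. Qed.

Lemma eqmodXD n p p' q q' :
  eqmodX n p p' -> eqmodX n q q' -> eqmodX n (p + q) (p' + q').
Proof. by move=> pp qq i lt_in; rewrite !coefD pp ?qq. Qed.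

Lemma eqmodXM n p p' q q' :
  eqmodX n p p' -> eqmodX n q q' -> eqmodX n (p * q) (p' * q').
Proof.
move=> pp qq i lt_in; rewrite !coefM; apply: eq_bigr => j _.
rewrite pp ?qq //; first exact: leq_ltn_trans (leq_subr _ _) lt_in.
by apply: leq_trans lt_in; exact: ltn_ord.
Qed.

Lemma eqmodXX n p q r : eqmodX n p q -> eqmodX n (p ^+ r) (q ^+ r).
Proof. by move=> pq; elim: r => // r IHr; rewrite !exprS; apply: eqmodXM. Qed.

(** A nonzero constant term makes [p] invertible as a power series; strong induction extracts the
    coefficients one at a time. *)
Lemma eqmodX_mulI n p q r :
  p`_0 != 0 -> eqmodX n (p * q) (p * r) -> eqmodX n q r.
Proof.
move=> p0 pqr i; elim/ltn_ind: i => i IHi lt_in.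
have := pqr i lt_in; rewrite !coefM !big_ord_recl !subn0.
rewrite (eq_bigr (fun j : 'I_i => p`_(lift ord0 j) * r`_(i - lift ord0 j))).
  by move/addIr/(mulfI p0).
move=> j _; rewrite IHi //.
  by rewrite /= /bump leq0n add1n ltn_subrL (leq_trans _ (ltn_ord j)).
exact: leq_ltn_trans (leq_subr _ _) lt_in.
Qed.

Lemma eqmodX_deriv n p q :
  eqmodX n p q -> eqmodX n.-1 p^`() q^`().
Proof. by case: n => // n pq i lt_in; rewrite !coef_deriv pq. Qed.

Lemma coefX_eq0 U i r : U`_0 = 0 -> (i < r)%N -> (U ^+ r)`_i = 0.
Proof.
move=> U0; elim: r i => // r IHr i; rewrite ltnS => le_ir.
rewrite exprS coefM big_ord_recl U0 mul0r add0r big1 // => j _.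
rewrite IHr ?mulr0 // (leq_trans _ le_ir) //.
by rewrite /= /bump leq0n add1n ltn_subrL (leq_trans _ (ltn_ord j)).
Qed.

End Congruence.

(** * The truncated logarithm and its functional equation *)

Section TruncatedLog.
Variables (F : fieldType) (n : nat).
Hypothesis unit_lt : forall r, (0 < r < n)%N -> r%:R != 0 :> F.
Implicit Types U V c : {poly F}.

(* log (1 + U) modulo 'X^n; the term r = 0 vanishes because 0^-1 = 0. *)
Definition plog U := \sum_(r < n) ((-1) ^+ r.-1 / r%:R) *: U ^+ r.

Lemma plog_eqmodX U V : eqmodX n U V -> eqmodX n (plog U) (plog V).
Proof.
move=> UV i lt_in; rewrite !coef_sum; apply: eq_bigr => r _.
by rewrite !coefZ (eqmodXX _ UV).
Qed.

Lemma coef0_plog U : U`_0 = 0 -> (plog U)`_0 = 0.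
Proof.
move=> U0; rewrite coef_sum big1 // => -[[|r] lt_rn] _; rewrite coefZ /=.
  by rewrite invr0 mulr0 mul0r.
by rewrite coefX_eq0 ?mulr0.
Qed.

Lemma plog_comp U c : plog U \Po c = plog (U \Po c).
Proof.
rewrite /plog raddf_sum; apply: eq_bigr => r _.
by rewrite /= comp_polyZ rmorphXn.
Qed.

(** This is log(1 + U)' = U' / (1 + U) with the denominator cleared; truncation costs one degree. *)
Lemma deriv_plog U : U`_0 = 0 ->
  eqmodX n.-1 ((1 + U) * (plog U)^`()) U^`().
Proof.
move=> U0.
(* The derivative is a finite geometric sum in -U times U'. Closing that sum leaves an error
   (-U)^(n-1) U', which has no coefficient below n - 1. *)
suff -> : (1 + U) * (plog U)^`() = (1 - (- U) ^+ n.-1) * U^`().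
  move=> i lt_in; rewrite mulrBl mul1r coefB [X in _ - X](_ : _ = 0) ?subr0 //.
  rewrite coefM big1 // => j _; rewrite coefX_eq0 ?mul0r //.
    by rewrite coefN U0 oppr0.
  by apply: leq_ltn_trans lt_in; rewrite -ltnS.
have -> : (plog U)^`() = (\sum_(r < n.-1) (- U) ^+ r) * U^`().
  rewrite /plog; case: n unit_lt => [|m] unit_ltm.
    by rewrite !big_ord0 mul0r deriv0.
  rewrite big_ord_recl /= invr0 mulr0 scale0r add0r raddf_sum mulr_suml.
  apply: eq_bigr => r _; rewrite /= derivZ deriv_exp /bump leq0n add1n /=.
  have /unit_ltm r_unit : (0 < r.+1 < m.+1)%N by rewrite /= ltnS.
  have -> : (- U) ^+ r = (-1) ^+ r *: U ^+ r by rewrite -scaleN1r exprZn.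
  by rewrite -scaler_nat scalerA divfK // add0n mulrC scalerAl.
by rewrite mulrA; congr (_ * _); rewrite -opprB subrX1 -mulNr opprB opprK.
Qed.

(** The coefficient of index i + 1 < n is recovered from the derivative by dividing by i + 1, a unit
    by [unit_lt]. *)
Lemma eqmodX_antideriv U V :
  U`_0 = V`_0 -> eqmodX n.-1 U^`() V^`() -> eqmodX n U V.
Proof.
move=> UV0 UV [|i] lt_in //; have /UV : (i < n.-1)%N by case: n lt_in.
rewrite !coef_deriv -(mulr_natr U`__) -(mulr_natr V`__).
exact/mulIf/unit_lt.
Qed.

(** Both sides vanish at 0, and their derivatives agree after multiplication by 1 + W = (1 + U)(1 +
    V), by the Leibniz rule. *)
Lemma plogM U V : U`_0 = 0 -> V`_0 = 0 ->
  eqmodX n (plog ((1 + U) * (1 + V) - 1)) (plog U + plog V).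
Proof.
move=> U0 V0; set W := _ - 1.
have AB0 : ((1 + U) * (1 + V))`_0 = 1.
  by rewrite coef0M !coefD !coefC /= U0 V0 !addr0 mulr1.
have W0 : W`_0 = 0 by rewrite coefB AB0 coefC subrr.
apply: eqmodX_antideriv; first by rewrite coefD !coef0_plog ?addr0.
have defW : 1 + W = (1 + U) * (1 + V) by rewrite addrC subrK.
apply: (@eqmodX_mulI _ _ (1 + W)); first by rewrite defW AB0 oner_eq0.
apply: eqmodX_trans (deriv_plog W0) _.
have -> : W^`() = U^`() * (1 + V) + (1 + U) * V^`().
  by rewrite /W derivB derivM !derivD -polyC1 !derivC !add0r subr0.
rewrite derivD defW [X in eqmodX _ _ X]mulrDr; apply: eqmodXD.
  rewrite mulrAC; apply: eqmodXM => //.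
  exact: eqmodX_sym (deriv_plog U0).
rewrite -mulrA; apply: eqmodXM => //; exact: eqmodX_sym (deriv_plog V0).
Qed.

(** By [deriv_plog], coefficient i + 1 of U is determined by the logarithm and the coefficients of U
    up to i, so induction applies. *)
Lemma plog_inj U V : U`_0 = 0 -> V`_0 = 0 ->
  eqmodX n (plog U) (plog V) -> eqmodX n U V.
Proof.
move=> U0 V0 UV; move=> i; elim/ltn_ind: i => -[|i] IHi lt_in.
  by rewrite U0 V0.
have lt_in1 : (i < n.-1)%N by case: n lt_in.
have:= deriv_plog V0 lt_in1; have:= deriv_plog U0 lt_in1.
suff -> : ((1 + U) * (plog U)^`())`_i = ((1 + V) * (plog V)^`())`_i.
  move=> ->; rewrite !coef_deriv -(mulr_natr U`__) -(mulr_natr V`__).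
  exact/mulIf/unit_lt.
have := eqmodX_deriv UV; move/(eqmodX_leq lt_in1) => UV'.
apply: (@eqmodXM _ i.+1) => // j; rewrite ltnS => le_ji.
rewrite !coefD IHi ?ltnS //; exact: leq_ltn_trans le_ji (ltnW lt_in).
Qed.

End TruncatedLog.

(** * The multinomial theorem with divided factorials *)

Section Multinomial.
Variables (F : fieldType) (A : comAlgType F) (m : nat).
Hypothesis fact_unit : forall r, (r < m)%N -> r`!%:R != 0 :> F.

(** [P] agrees with the exponential series exp(aT) below degree [m]. *)
Definition exp_coefs (P : {poly A}) (a : A) :=
  forall r, (r < m)%N -> P`_r = (r`!%:R^-1 : F) *: a ^+ r.

Lemma exp_coefsM P Q a b :
  exp_coefs P a -> exp_coefs Q b -> exp_coefs (P * Q) (a + b).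
Proof.
move=> Pa Qb r lt_rm; rewrite coefMr exprDn scaler_sumr.
apply: eq_bigr => j _; have le_jr : (j <= r)%N by rewrite -ltnS.
have lt_jm : (j < m)%N := leq_ltn_trans le_jr lt_rm.
have lt_rjm : (r - j < m)%N := leq_ltn_trans (leq_subr _ _) lt_rm.
rewrite Pa // Qb // -scalerAl -scalerAr scalerA -scaler_nat scalerA.
congr (_ *: _); apply: (mulfI (fact_unit lt_rm)).
rewrite [RHS]mulrA mulfV ?fact_unit // mul1r -(bin_fact le_jr) !natrM.
by rewrite -!mulrA mulVKf ?fact_unit // mulfV ?fact_unit ?mulr1.
Qed.

(** Compare the coefficients of T^r in exp((sum of the a_j) T) and in the product of the exp(a_j T),
    each truncated below degree [m], where the factorials are invertible. *)
Lemma multinomial n (a : 'I_n -> A) r : (r < m)%N ->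
  (r`!%:R^-1 : F) *: (\sum_j a j) ^+ r =
  \sum_(k : {ffun 'I_n -> 'I_m} | (\sum_j k j == r)%N)
     ((\prod_j (k j)`!)%N%:R^-1 : F) *: \prod_j a j ^+ k j.
Proof.
move=> lt_rm; pose P j := \poly_(k < m) ((k`!%:R^-1 : F) *: a j ^+ k).
have Pa : exp_coefs (\prod_j P j) (\sum_j a j).
  elim/big_ind2: _ => [q lt_q||j _ q lt_q].
  - rewrite coefC; case: q lt_q => [|q] _ /=; first by rewrite invr1 scale1r.
    by rewrite exprS mul0r scaler0.
  - by move=> P1 a1 P2 a2; apply: exp_coefsM.
  by rewrite coef_poly lt_q.
rewrite -(Pa r lt_rm) /P.
under eq_bigr do rewrite poly_def.
rewrite bigA_distr_bigA coef_sum [RHS]big_mkcond.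
apply: eq_bigr => k _.
rewrite scaler_prod prodrXr coefZ coefXn eq_sym scaler_prod.
case: eqP => _; rewrite ?mulr1 ?mulr0 //.
by rewrite natr_prod prodfV.
Qed.

End Multinomial.

(** * The polynomials theta_i as coefficients of the logarithm *)

Section ThetaLog.
Variable F : fieldType.

(** Each power U^r is expanded by the multinomial theorem. The coefficient of X^i keeps the
    exponents k of weight i, and r is the total of k. *)
Lemma theta_plog n i (x : nat -> F) (U : {poly F}) :
  (forall r, (0 < r < n)%N -> r%:R != 0 :> F) ->
  (0 < i < n)%N -> U`_0 = 0 ->
  (forall j, (0 < j <= i)%N -> U`_j = x j / x 0%N) ->
  theta i x = (plog n U)`_i.
Proof.
move=> unit_lt /andP[i_gt0 lt_in] U0 Ux.
have fact_unit r : (r < i.+1)%N -> r`!%:R != 0 :> F.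
  elim: r => [|r IHr] le_ri; first by rewrite oner_eq0.
  rewrite factS natrM mulf_neq0 ?IHr //; last exact: ltnW.
  by apply: unit_lt; rewrite /= (leq_ltn_trans _ lt_in).
pose a (j : 'I_i) : {poly F} := (x j.+1 / x 0%N) *: 'X^(j.+1).
have Ua : eqmodX i.+1 U (\sum_j a j).
  move=> [|j] lt_ji; rewrite coef_sum.
    by rewrite big1 // => j _; rewrite coefZ coefXn mulr0.
  rewrite (bigD1 (Ordinal (lt_ji : (j < i)%N))) //= coefZ coefXn eqxx mulr1.
  rewrite big1 ?addr0 ?Ux // => l; rewrite -val_eqE /= => ne_lj.
  by rewrite coefZ coefXn eqSS eq_sym (negPf ne_lj) mulr0.
(* Powers U^r with r > i do not reach X^i, so only r <= i remains. *)
rewrite /plog -(subnKC lt_in) big_split_ord /= coefD [X in _ + X]coef_sum.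
rewrite [X in _ + X]big1 ?addr0; last first.
  by move=> r _; rewrite coefZ coefX_eq0 ?mulr0 // ltn_addr.
(* [cf r] is the factor of theta for exponents of total r; the logarithm's (-1)^(r-1) / r equals
   [cf r] / r!, and the multinomial theorem absorbs the 1 / r!. *)
pose cf r := ((-1) ^+ r.-1 * r.-1`!%:R : F).
have termE (r : 'I_i.+1) : (((-1) ^+ r.-1 / r%:R) *: U ^+ r)`_i =
    \sum_(k : {ffun 'I_i -> 'I_i.+1} |
           (\sum_(j < i) j.+1 * k j == i)%N && (\sum_j k j == r)%N)
      cf r / (\prod_j (k j)`!)%N%:R * \prod_(j < i) (x j.+1 / x 0%N) ^+ k j.
  rewrite coefZ (eqmodXX r Ua) //.
  (* For r = 0 the left side vanishes because 0^-1 = 0, and the right side is empty because total 0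
     forces weight 0 < i. *)
  have [r0 | r_gt0] := posnP r.
    rewrite r0 invr0 mulr0 mul0r big1 // => k /andP[/eqP wk].
    rewrite sum_nat_eq0 => /forallP k0.
    case/eqP: (lt0n_neq0 i_gt0); rewrite -[LHS]wk big1 // => j _.
    by rewrite (eqP (k0 j)) muln0.
  have -> : (-1) ^+ r.-1 / r%:R = cf r / r`!%:R :> F.
    have r_unit : r%:R != 0 :> F.
      by apply: unit_lt; rewrite r_gt0 (leq_trans (ltn_ord r)).
    have le_r1 : (r.-1 < i.+1)%N := leq_ltn_trans (leq_pred r) (ltn_ord r).
    have -> : r`! = (r * r.-1`!)%N by rewrite -{1 2}(prednK r_gt0) factS.
    rewrite /cf natrM invfM -mulrA; congr (_ * _).
    by rewrite mulrCA mulfV ?fact_unit // mulr1.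
  rewrite -mulrA -coefZ (multinomial fact_unit) // coef_sum mulr_sumr.
  rewrite big_mkcondl /=; apply: eq_bigr => k _.
  have -> : \prod_j a j ^+ k j = (\prod_(j < i) (x j.+1 / x 0%N) ^+ k j)
      *: 'X^(\sum_(j < i) j.+1 * k j).
    rewrite -prodrXr -scaler_prod; apply: eq_bigr => j _.
    by rewrite exprZn -exprM.
  rewrite !coefZ coefXn eq_sym.
  by case: eqP => _; rewrite ?mulr1 ?mulr0 // mulrA.
rewrite coef_sum (eq_bigr _ (fun r _ => termE r)).
rewrite (exchange_big_dep (fun k : {ffun 'I_i -> 'I_i.+1} =>
  \sum_(j < i) j.+1 * k j == i)%N) /=; last by move=> r k _ /andP[].
apply: eq_bigr => k wk.
(* The total of k is at most its weight i, so k is counted for exactly one r. *)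
have le_ki : (\sum_j k j < i.+1)%N.
  rewrite ltnS -[leqRHS](eqP wk); apply: leq_sum => j _.
  by rewrite leq_pmull.
rewrite (big_pred1 (Ordinal le_ki)) /cf //= => r.
by rewrite wk eq_sym.
Qed.

Lemma theta_rmorph (K : fieldType) (e : {rmorphism F -> K}) i x :
  theta i (fun j => e (x j)) = e (theta i x).
Proof.
rewrite /theta rmorph_sum; apply: eq_bigr => k _.
rewrite !rmorphM fmorphV !rmorph_nat rmorphXn rmorphN1; congr (_ * _).
rewrite rmorph_prod; apply: eq_bigr => j _.
by rewrite rmorphXn fmorph_div.
Qed.

End ThetaLog.

(** * Behaviour of theta under products and substitutions *)

Section ThetaOperations.
Variables (F : fieldType) (m : nat).
Hypothesis unit_lt : forall r, (0 < r < m)%N -> r%:R != 0 :> F.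
Implicit Types (x y w : nat -> F) (c : {poly F}).

(** Chosen so that 1 + [upoly x] is the generating polynomial of x divided by x_0, whose logarithm
    has the theta_i as coefficients. *)
Definition upoly x : {poly F} := (x 0%N)^-1 *: \poly_(i < m) x i - 1.

Lemma coef_upoly x i :
  (i < m)%N -> (upoly x)`_i = x i / x 0%N - (i == 0%N)%:R.
Proof. by move=> lt_im; rewrite coefB coefZ coef_poly lt_im coef1 mulrC. Qed.

Lemma upoly0 x : (0 < m)%N -> x 0%N != 0 -> (upoly x)`_0 = 0.
Proof. by move=> m_gt0 x0; rewrite coef_upoly // divff // subrr. Qed.

Lemma theta_upoly x i : x 0%N != 0 -> (0 < i < m)%N ->
  theta i x = (plog m (upoly x))`_i.
Proof.
move=> x0 lt_0im; have /andP[i_gt0 lt_im] := lt_0im.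
apply: theta_plog => //; first by rewrite upoly0 // (ltn_trans i_gt0).
move=> j /andP[j_gt0 le_ji]; rewrite coef_upoly ?(leq_ltn_trans le_ji) //.
by rewrite eqn0Ngt j_gt0 subr0.
Qed.

Lemma theta_mul x y w i : x 0%N != 0 -> y 0%N != 0 ->
  (forall j, (j < m)%N -> w j = \sum_(l < j.+1) x l * y (j - l)%N) ->
  (0 < i < m)%N -> theta i w = theta i x + theta i y.
Proof.
move=> x0 y0 wE lt_0im; have /andP[i_gt0 lt_im] := lt_0im.
have m_gt0 : (0 < m)%N := ltn_trans i_gt0 lt_im.
have w0E : w 0%N = x 0%N * y 0%N by rewrite wE // big_ord1.
have w0 : w 0%N != 0 by rewrite w0E mulf_neq0.
rewrite !theta_upoly // -coefD.
rewrite -(plogM unit_lt (upoly0 m_gt0 x0) (upoly0 m_gt0 y0) lt_im).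
apply: plog_eqmodX lt_im => j lt_jm.
rewrite /upoly [1 + _]addrC subrK [1 + _]addrC subrK.
rewrite !coefB; congr (_ - _).
rewrite -scalerAl -scalerAr scalerA !coefZ coefM coef_poly lt_jm w0E invfM.
rewrite wE //; congr (_ * _); apply: eq_bigr => l _.
rewrite !coef_poly (leq_ltn_trans (leq_subr _ _) lt_jm).
by rewrite (leq_ltn_trans _ lt_jm) // -ltnS.
Qed.

Lemma theta_inj x y : (0 < m)%N -> x 0%N != 0 -> x 0%N = y 0%N ->
  (forall i, (0 < i < m)%N -> theta i x = theta i y) ->
  forall i, (i < m)%N -> x i = y i.
Proof.
move=> m_gt0 x0 xy0 xy i lt_im; have y0 : y 0%N != 0 by rewrite -xy0.
have /(plog_inj unit_lt (upoly0 m_gt0 x0) (upoly0 m_gt0 y0)) :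
    eqmodX m (plog m (upoly x)) (plog m (upoly y)).
  case=> [|j] lt_jm; first by rewrite !coef0_plog ?upoly0.
  by rewrite -!theta_upoly // xy.
move/(_ i lt_im); rewrite !coef_upoly // => /addIr; rewrite -xy0.
exact/mulIf/invr_neq0.
Qed.

Lemma coef_comp_poly_lt (q c : {poly F}) b : c`_0 = 0 -> (b < m)%N ->
  (q \Po c)`_b = \sum_(a < m) q`_a * (c ^+ a)`_b.
Proof.
move=> c0 lt_bm; rewrite coef_comp_poly.
pose G a := q`_a * (c ^+ a)`_b.
(* Both sums extend to this common range: beyond [size q] the coefficients of q vanish, and from [m]
   on c^a has no coefficient b. *)
transitivity (\sum_(a < size q + m) G a).
  rewrite big_split_ord /= [X in _ = _ + X]big1 ?addr0 // => a _.
  by rewrite /G nth_default ?mul0r ?leq_addr.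
rewrite addnC big_split_ord /= [X in _ + X = _]big1 ?addr0 // => a _.
by rewrite /G coefX_eq0 ?mulr0 // ltn_addr.
Qed.

(** The hypothesis on w says that its series is that of x with c(T) substituted for T, and
    [plog_comp] moves the substitution outside the logarithm. The term a = 0 drops out since the
    logarithm has no constant term. *)
Lemma theta_comp x w c b : x 0%N != 0 -> c`_0 = 0 ->
  (forall j, (j < m)%N -> w j = \sum_(a < m) x a * (c ^+ a)`_j) ->
  (0 < b < m)%N -> theta b w = \sum_(a < m.-1) theta a.+1 x * (c ^+ a.+1)`_b.
Proof.
move=> x0 c0 wE lt_0bm; have /andP[b_gt0 lt_bm] := lt_0bm.
have m_gt0 : (0 < m)%N := ltn_trans b_gt0 lt_bm.
have w0E : w 0%N = x 0%N.
  rewrite wE //; case: (m) m_gt0 => // m' _; rewrite big_ord_recl coef1 mulr1.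
  by rewrite big1 ?addr0 // => a _; rewrite coefX_eq0 // mulr0.
have w0 : w 0%N != 0 by rewrite w0E.
rewrite theta_upoly //.
have /plog_eqmodX/(_ b lt_bm) -> : eqmodX m (upoly w) (upoly x \Po c).
  move=> j lt_jm; rewrite comp_polyB comp_polyZ !coefB !coefZ w0E.
  rewrite -polyC1 comp_polyC; congr (_ * _ - _).
  rewrite coef_comp_poly_lt // coef_poly lt_jm wE //.
  by apply: eq_bigr => a _; rewrite coef_poly ltn_ord.
rewrite -plog_comp coef_comp_poly_lt //.
have thE a : (a.+1 < m)%N -> (plog m (upoly x))`_a.+1 = theta a.+1 x.
  by move=> lt_am; rewrite theta_upoly.
have l0 : (plog m (upoly x))`_0 = 0 by rewrite coef0_plog ?upoly0.
case: (m) m_gt0 thE l0 => // m' _ thE l0.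
rewrite big_ord_recl l0 mul0r add0r; apply: eq_bigr => a _.
by rewrite thE // ltnS.
Qed.

End ThetaOperations.

(** * Matrices of J(m) and mu(c) acting on rows *)

Section RowCoefficients.

Lemma rcoef_ord (R : nmodType) m (x : 'rV[R]_m) (j : 'I_m) : rcoef x j = x 0 j.
Proof. by rewrite /rcoef valK. Qed.

Lemma rcoef_inj (R : nmodType) m (x y : 'rV[R]_m) :
  (forall i, (i < m)%N -> rcoef x i = rcoef y i) -> x = y.
Proof.
by move=> xy; apply/rowP => j; rewrite -!rcoef_ord xy.
Qed.

Lemma rcoef_map (R S : nmodType) (e : {additive R -> S}) m (x : 'rV[R]_m) j :
  rcoef (map_mx e x) j = e (rcoef x j).
Proof. by rewrite /rcoef; case: insub => [i|]; rewrite ?mxE ?raddf0. Qed.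

Variable F : finFieldType.

Lemma LambdaX m i (a b : 'I_m) :
  (Lambda F m ^+ i) a b = (b == a + i :> nat)%N%:R.
Proof.
elim: i a b => [|i IHi] a b; first by rewrite expr0 mxE addn0 eq_sym.
rewrite exprSr -mulmxE mxE.
have [lt_aim | le_mai] := ltnP (a + i) m.
  rewrite (bigD1 (Ordinal lt_aim)) //= IHi eqxx mul1r mxE /= addnS.
  rewrite big1 ?addr0 // => l; rewrite -val_eqE /= => ne_l.
  by rewrite IHi (negPf ne_l) mul0r.
rewrite big1 => [|l _]; first rewrite ltn_eqF //.
  by rewrite (leq_trans (ltn_ord b)) ?addnS ?leqW.
by rewrite IHi ltn_eqF ?mul0r // (leq_trans (ltn_ord l)).
Qed.

Lemma jmxE m (y : 'rV[F]_m) (a b : 'I_m) :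
  jmx y a b = if (a <= b)%N then rcoef y (b - a) else 0.
Proof.
rewrite summxE; case: leqP => [le_ab | lt_ba]; last first.
  by rewrite big1 // => i _; rewrite mxE LambdaX ltn_eqF ?mulr0 ?ltn_addr.
have lt_bam : (b - a < m)%N := leq_ltn_trans (leq_subr _ _) (ltn_ord b).
rewrite (bigD1 (Ordinal lt_bam)) //= mxE LambdaX /= subnKC // eqxx mulr1.
rewrite big1 ?addr0 ?(rcoef_ord y (Ordinal lt_bam)) // => i.
rewrite -val_eqE /= => ne_i.
rewrite mxE LambdaX [_ == _](_ : _ = false) ?mulr0 //.
by apply: contra_neqF ne_i => /eqP ->; rewrite addKn.
Qed.

Lemma rcoef_mul_jmx m (x y : 'rV[F]_m) j : (j < m)%N ->
  rcoef (x *m jmx y) j = \sum_(l < j.+1) rcoef x l * rcoef y (j - l)%N.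
Proof.
move=> lt_jm; rewrite (rcoef_ord _ (Ordinal lt_jm)) mxE.
rewrite (big_ord_widen m (fun l => rcoef x l * rcoef y (j - l)%N)) //.
rewrite [RHS]big_mkcond; apply: eq_bigr => l _.
by rewrite jmxE rcoef_ord ltnS; case: leqP; rewrite ?mulr0.
Qed.

Lemma jcoef_jmx m (y : 'rV[F]_m) j : (0 < m)%N -> jcoef (jmx y) j = rcoef y j.
Proof.
move=> m_gt0; rewrite /jcoef insubT /rcoef; case: insub => [i|] //.
by rewrite mxE jmxE /= subn0 rcoef_ord.
Qed.

(** Expanding c^a picks one exponent from each factor; since c has no constant term, only positive
    exponents of sum b contribute. *)
Lemma mu_coef_exp (y : nat -> F) (c : {poly F}) a b : c`_0 = 0 ->
  (forall j, (0 < j <= b)%N -> c`_j = y j) ->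
  mu_coef a b y = (c ^+ a)`_b.
Proof.
(* The value [y 0] is unconstrained (inside [mu] it is c_1), so it is replaced by 0. *)
move=> c0 cE; pose y0 j := if (0 < j)%N then y j else 0.
have /eqmodXX/(_ b (ltnSn b)) -> :
    eqmodX b.+1 c (\sum_(j < b.+1) y0 j *: 'X^j).
  move=> j lt_jb; rewrite -(poly_def b.+1 y0) coef_poly lt_jb /y0.
  by case: j lt_jb => // j lt_jb; rewrite cE.
rewrite -[in RHS](card_ord a) -prodr_const bigA_distr_bigA coef_sum.
rewrite /mu_coef big_mkcond; apply: eq_bigr => j _.
rewrite scaler_prod prodrXr coefZ coefXn [b == _]eq_sym.
case: forallP => [j_gt0 | /forallP/forallPn[r]] /=.
  case: eqP => _; rewrite ?mulr0 // mulr1; apply: eq_bigr => r _.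
  by rewrite /y0 j_gt0.
by rewrite -leqNgt leqn0 => /eqP jr0; rewrite (bigD1 r) //= /y0 jr0 !mul0r.
Qed.

End RowCoefficients.

(** * Characters of J(m) as functions of the first row *)

Section RowCharacters.
Variables (F : finFieldType) (C : numClosedFieldType) (psi : F -> C).
Hypothesis psi_char : additive_character psi.
Variable m : nat.
Hypothesis m_gt0 : (0 < m)%N.
Hypothesis unit_lt : forall r, (0 < r < m)%N -> r%:R != 0 :> F.
Implicit Types (chi : jchar F C m) (x y : 'rV[F]_m).

Definition row_char chi (x : nat -> F) : C :=
  chi.1 (x 0%N) * \prod_(i < m.-1) psi (chi.2 0 i * theta i.+1 x).

Lemma prod_psi (I : finType) (G : I -> F) :
  \prod_i psi (G i) = psi (\sum_i G i).
Proof. by case: psi_char => psi0 psiD; rewrite (big_morph psi psiD psi0). Qed.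

Lemma row_char_mul chi x y : rcoef x 0 != 0 -> rcoef y 0 != 0 ->
  row_char chi (rcoef (x *m jmx y)) =
  row_char chi (rcoef x) * row_char chi (rcoef y).
Proof.
move=> x0 y0; rewrite /row_char mulrACA; congr (_ * _).
  by rewrite rcoef_mul_jmx // big_ord1 mulcharM.
rewrite -big_split /=; apply: eq_bigr => i _; case: psi_char => _ <-.
rewrite -mulrDr (theta_mul unit_lt x0 y0 _) //; first exact: rcoef_mul_jmx.
by rewrite /= -ltn_predRL.
Qed.

Lemma rcoef_mul_mu0 x (c : 'rV[F]_m.-1) : rcoef (x *m mu c) 0 = rcoef x 0.
Proof.
rewrite !(rcoef_ord _ (Ordinal m_gt0)) mxE (bigD1 (Ordinal m_gt0)) //=.
have mu0 a : mu_coef a 0 (fun j => rcoef c j.-1) = (a == 0%N)%:R.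
  (* For b = 0 no coefficient is constrained, so c = 0 is allowed and the value is 0^a. *)
  rewrite (@mu_coef_exp _ _ 0) ?coef0 //; last by case.
  by rewrite expr0n; case: (a == 0%N); rewrite coefC.
rewrite mxE mu0 mulr1 big1 ?addr0 // => a; rewrite -val_eqE /= => a0.
by rewrite mxE mu0 (negPf a0) mulr0.
Qed.

(** Substitution by c acts on the vector of the theta_i(x) through mu(c)'; moving this matrix across
    the pairing with a transposes it. *)
Lemma row_char_mu chi x (c : 'rV[F]_m.-1) : rcoef x 0 != 0 ->
  row_char chi (rcoef (x *m mu c)) = row_char (jchar_tmu chi c) (rcoef x).
Proof.
move=> x0; rewrite /row_char /= rcoef_mul_mu0; congr (_ * _).
(* The substituted series, the sum of the c_j T^j; the shift undoes the storage of c_j at index j -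
   1. *)
pose cp := \poly_(j < m) (if j is j'.+1 then rcoef c j' else 0).
have cp0 : cp`_0 = 0 by rewrite coef_poly if_same.
have muE a b : (b < m)%N ->
    mu_coef a b (fun j => rcoef c j.-1) = (cp ^+ a)`_b.
  move=> lt_bm; apply: mu_coef_exp => // -[|j] //= le_jb.
  by rewrite coef_poly (leq_ltn_trans le_jb).
rewrite !prod_psi; congr psi.
under eq_bigr => b _.
  rewrite (theta_comp unit_lt x0 cp0); first over.
    move=> j lt_jm; rewrite (rcoef_ord _ (Ordinal lt_jm)) mxE.
    by apply: eq_bigr => a _; rewrite mxE muE // rcoef_ord.
  by rewrite /= -ltn_predRL.
under eq_bigr do rewrite mulr_sumr.
rewrite exchange_big; apply: eq_bigr => a _.
rewrite mxE mulr_suml; apply: eq_bigr => b _.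
by rewrite !mxE muE -?ltn_predRL // -mulrA [_ * theta _ _]mulrC.
Qed.

End RowCharacters.

(** * Frobenius, Kummer and Artin-Schreier equations over F *)

Section FiniteSubfield.
Variables (F : finFieldType) (K : closedFieldType) (e : {rmorphism F -> K}).

(** X^q - X splits as the product of the X - y over y in F, so it has no other roots in K. *)
Lemma frob_fixedP (x : K) : x ^+ #|F| = x -> exists y, x = e y.
Proof.
move=> xq; have : (map_poly e ('X^#|F| - 'X)).[x] = 0.
  by rewrite rmorphB /= map_polyXn map_polyX !hornerE xq subrr.
rewrite finField_genPoly rmorph_prod horner_prod => /eqP/prodf_eq0[y _].
by rewrite /= map_polyXsubC hornerXsubC subr_eq0 => /eqP; exists y.
Qed.

Lemma frob_rmorph (y : F) : e y ^+ #|F| = e y.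
Proof. by rewrite -rmorphXn expf_card. Qed.

Lemma frobD (x y : K) : (x + y) ^+ #|F| = x ^+ #|F| + y ^+ #|F|.
Proof.
have [p p_pr pF] := finPcharP F; apply: exprDn_pchar.
rewrite [#|F|](card_pprimeChar pF) pnatX pnatE //.
by rewrite (fmorph_pchar e) pF.
Qed.

Lemma frob_pred (x : K) : x ^+ #|F| = x ^+ #|F|.-1 * x.
Proof. by rewrite -exprSr prednK // (ltn_trans _ (finNzRing_gt1 F)). Qed.

Lemma expf_card_pred (y : F) : y != 0 -> y ^+ #|F|.-1 = 1.
Proof.
move=> y0; apply: (mulIf y0); rewrite mul1r -exprSr.
by rewrite prednK ?expf_card // (ltn_trans _ (finNzRing_gt1 F)).
Qed.

Lemma kummer_root (a : F) : a != 0 ->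
  exists t : K, t ^+ #|F|.-1 = e a /\ t != 0.
Proof.
move=> a0; have q1 : (0 < #|F|.-1)%N by rewrite -subn1 subn_gt0 finNzRing_gt1.
have [t tE] := solve_monicpoly (fun i => if i == 0%N then e a else 0) q1.
have {}tE : t ^+ #|F|.-1 = e a.
  rewrite tE (bigD1 (Ordinal q1)) //= mulr1 big1 ?addr0 // => i.
  by rewrite -val_eqE /= => /negPf ->; rewrite mul0r.
exists t; split=> //; apply: contra_eq_neq tE => ->.
by rewrite expr0n gtn_eqF // eq_sym fmorph_eq0.
Qed.

Lemma artin_schreier_root (a : K) : exists u : K, u ^+ #|F| = u + a.
Proof.
have q1 := finNzRing_gt1 F; have q0 := ltnW q1.
have [u uE] := solve_monicpoly
  (fun i => if i == 0%N then a else if i == 1%N then 1 else 0) q0.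
exists u; rewrite uE (bigD1 (Ordinal q0)) //= mulr1 addrC; congr (_ + _).
rewrite (bigD1 (Ordinal q1)) //= mul1r expr1 big1 ?addr0 // => i.
by rewrite -!val_eqE /= => /andP[/negPf -> /negPf ->]; rewrite mul0r.
Qed.

End FiniteSubfield.

(** * Column blocks of z under block matrices *)

Section Blocks.
Variables (F : finFieldType) (k : nat) (ns ps : 'I_k -> nat) (d : nat).
Implicit Types (z : 'M[F]_(d, psum ns ps)) (b : part_index ps).

Lemma diag_blockK (B : forall b, 'M[F]_(part_size ns b)) b :
  diag_block (block_diag B) b = B b.
Proof.
by case: b => i j; rewrite /diag_block /block_diag !submxblock_diag.
Qed.

Lemma zblock_mull d' (g : 'M[F]_(d', d)) z b :
  zblock (g *m z) b = g *m zblock z b.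
Proof. by rewrite /zblock -!mul_submxrow. Qed.

Lemma submxrow_mul_mxdiag n l (q : 'I_l -> nat) (A : 'M[F]_(n, \sum_i q i))
    (D : forall i, 'M[F]_(q i)) i :
  submxrow (A *m \mxdiag_i D i) i = submxrow A i *m D i.
Proof. by rewrite -{1}[A]submxrowK mul_mxrow_mxdiag mxrowK. Qed.

Lemma zblock_block_diag z (B : forall b, 'M[F]_(part_size ns b)) b :
  zblock (z *m block_diag B) b = zblock z b *m B b.
Proof. by case: b => i j; rewrite /zblock !submxrow_mul_mxdiag. Qed.

(** The block of z that w moves to position b: block column j of the permutation matrix has its
    identity in block row sigma(j). *)
Definition W_index (w : W_Delta F ns ps) b : part_index ps :=
  Tagged (fun i => 'I_(ps i)) (W_perm w (tag b) (tagged b)).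

(** Stated for an explicit pair (i, j), so that the sizes of the blocks [b] and [W_index w b] are
    both convertible to [ns i]. *)
Lemma zblock_W_mx z w i j (b := Tagged (fun i => 'I_(ps i)) j) :
  zblock (z *m W_mx w) b =
  zblock z (W_index w b) *m mu (W_coef w (W_index w b))
    :> 'M[F]_(d, ns i).
Proof.
rewrite /zblock /W_mx submxrow_mul_mxdiag /=.
set A := submxrow z i; rewrite mulmxA.
rewrite -[A *m _]submxrowK /perm_block mul_mxrow_mxblock mxrowK.
rewrite (bigD1 (W_perm w i j)) //= eqxx mulmx1 submxrow_mul_mxdiag.
by rewrite big1 ?addr0 // => a /negPf ->; rewrite mulmx0.
Qed.

End Blocks.

(** * Counting points and the formula for N(X; chi) *)

Section Counting.
Variables (F : finFieldType) (K : closedFieldType) (e : {rmorphism F -> K}).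
Variables (k : nat) (ns ps : 'I_k -> nat) (d : nat).
Implicit Types (z : 'M[F]_(d, psum ns ps)) (b : part_index ps).
Local Notation rows := (forall b : part_index ps, 'rV[F]_(part_size ns b)).

Definition row_iota (y : rows) : G_elt F ns ps :=
  ([ffun b => rcoef (y b) 0],
   [ffun v : u_index ns ps => theta (tagged v).+1 (rcoef (y (tag v)))]).

Definition sz z (s : 'rV[F]_d) : rows := fun b => s *m zblock z b.

(** The group G_Delta as a set: [G_elt] also contains tuples with zero entries. *)
Definition unit_part :
    {set {ffun part_index ps -> F} * {ffun u_index ns ps -> F}} :=
  [set x : {ffun part_index ps -> F} * {ffun u_index ns ps -> F}
     | [forall b, x.1 b != 0]].

(** Frob P = g P amounts to s rational, t^(q-1) = g.1 and u^q - u = g.2. Membership in X then says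
    that s z has invariants g, and the pairs (t, u) form a G_Delta-torsor. *)
Lemma card_twisted_points z (g : G_elt F ns ps) : (forall b, g.1 b != 0) ->
  #|` fset_set [set P | X_Delta e z P /\
                        Frob F P = G_act e g P]%classic| =
  (#|unit_part| * #|[set s | row_iota (sz z s) == g]|)%N.
Proof.
move=> g0.
(* The pair (t0, u0) is a base point of the torsor; [f] translates it by a rational pair. *)
have [t0 t0P] := fin_all_exists (fun b => kummer_root e (g0 b)).
have [u0 u0P] := fin_all_exists (fun v => artin_schreier_root F (e (g.2 v))).
pose f (x : {ffun part_index ps -> F} * {ffun u_index ns ps -> F} * 'rV[F]_d)
    : Defs.point ns ps K d :=
  ([ffun b => t0 b * e (x.1.1 b)], [ffun v => u0 v + e (x.1.2 v)],
   map_mx e x.2).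
have f_inj : injective f.
  move=> [[x1 x2] x3] [[y1 y2] y3] [/ffunP E1 /ffunP E2 /map_mx_inj E3].
  congr (_, _, _) => //; apply/ffunP => b.
    have := E1 b; rewrite !ffunE => /(mulfI (proj2 (t0P b))).
    exact: fmorph_inj.
  by have := E2 b; rewrite !ffunE => /addrI/fmorph_inj.
rewrite -cardsX; set S := finset.setX _ _.
rewrite (_ : [set P | _]%classic = [set` [fset f x | x in S]%fset]%classic).
  by rewrite set_fsetK card_imfset //= -cardE.
have szE (s : 'rV[F]_d) b :
    rcoef (map_mx e s *m map_mx e (zblock z b)) =
    fun j => e (rcoef (sz z s b) j).
  by apply: funext => j; rewrite -map_mxM rcoef_map.
apply/seteqP; split=> [[[t u] s] | P].
  move=> [[tP uP tn0] [/ffunP Ft /ffunP Fu Fs]].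
  apply/imfsetP => /=.
  have [s' sE] : exists s', s = map_mx e s'.
    have /fin_all_exists[s' s'P] j : exists y, s 0 j = e y.
      apply: frob_fixedP; have /rowP/(_ j) := Fs; by rewrite mxE.
    by exists (\row_j s' j); apply/rowP => j; rewrite !mxE s'P.
  have tN b : t b ^+ #|F|.-1 = e (g.1 b).
    by have := Ft b; rewrite !ffunE frob_pred => /(mulIf (tn0 b)).
  have uN v : u v ^+ #|F| = u v + e (g.2 v).
    by have := Fu v; rewrite !ffunE.
  (* t and t0 have the same (q-1)-st power, so their quotient is fixed by Frobenius; likewise for u
     - u0 below. *)
  have /fin_all_exists[x1 x1P] b : exists y, t b / t0 b = e y.
    apply: frob_fixedP; rewrite frob_pred expr_div_n tN (proj1 (t0P b)).
    by rewrite divff ?mul1r // fmorph_eq0.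
  have /fin_all_exists[x2 x2P] v : exists y, u v - u0 v = e y.
    apply: frob_fixedP; apply: (addIr (u0 v ^+ #|F|)).
    by rewrite -(frobD e) subrK uN u0P addrA subrK.
  exists ([ffun b => x1 b], [ffun v => x2 v], s'); last first.
    congr (_, _, _) => //; apply/ffunP => b; rewrite !ffunE.
      by rewrite -x1P mulrC divfK ?(proj2 (t0P b)).
    by rewrite -x2P addrC subrK.
  rewrite !inE /=; apply/andP; split.
    apply/forallP => b; rewrite ffunE -(fmorph_eq0 e) -x1P.
    by rewrite mulf_neq0 ?invr_eq0 ?tn0 ?(proj2 (t0P b)).
  have E1 b : rcoef (sz z s' b) 0 = g.1 b.
    by apply: (fmorph_inj e); rewrite -tN tP sE szE.
  apply/eqP; rewrite [RHS]surjective_pairing; congr (_, _); apply/ffunP.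
    by move=> b; rewrite ffunE E1.
  move=> v; rewrite ffunE; apply: (fmorph_inj e); have := uP v.
  (* t^((q-1)j) and the factor x_0^j of theta_bar are both g.1^j and cancel. *)
  rewrite sE szE uN addrC addKr /theta_bar theta_rmorph E1 exprM tN.
  by move/mulfI => -> //; rewrite expf_neq0 // fmorph_eq0.
move/imfsetP => /= [[[x1 x2] s]]; rewrite !inE /= => /andP[/forallP x1n0].
move=> /eqP sg ->.
have E1 b : rcoef (sz z s b) 0 = g.1 b by rewrite -sg ffunE.
have E2 (v : u_index ns ps) :
    theta (tagged v).+1 (rcoef (sz z s (tag v))) = g.2 v.
  by rewrite -sg ffunE.
have tN b : (t0 b * e (x1 b)) ^+ #|F|.-1 = e (g.1 b).
  by rewrite exprMn (proj1 (t0P b)) -rmorphXn expf_card_pred ?rmorph1 ?mulr1.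
have uN v : (u0 v + e (x2 v)) ^+ #|F| = u0 v + e (x2 v) + e (g.2 v).
  by rewrite (frobD e) u0P frob_rmorph addrAC.
split.
  split=> [b|v|b]; rewrite ?ffunE ?szE ?tN ?E1 //.
    rewrite exprM tN uN addrC addKr /theta_bar theta_rmorph E1 E2 //.
  by rewrite mulf_neq0 ?fmorph_eq0 ?(proj2 (t0P b)).
congr (_, _, _).
- by apply/ffunP => b; rewrite !ffunE frob_pred tN.
- by apply/ffunP => v; rewrite !ffunE uN.
by apply/rowP => j; rewrite !mxE frob_rmorph.
Qed.

Definition rows_mx (y : rows) : 'M[F]_(psum ns ps) :=
  block_diag (fun b => jmx (y b)).

Hypothesis ns_gt0 : forall i, (0 < ns i)%N.
Hypothesis unit_lt :
  forall i r, (0 < r < ns i)%N -> r%:R != 0 :> F.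

Lemma H_DeltaP (h : 'M[F]_(psum ns ps)) :
  reflect (exists2 y : rows, forall b, rcoef (y b) 0 != 0 & h = rows_mx y)
          (h \in H_Delta F ns ps).
Proof.
rewrite inE; apply: (iffP andP) => [[/eqP hE /forallP hJ] | [y y0 ->]].
  have /fin_all_exists2[y y0 yE] b :
      exists2 y, rcoef y 0 != 0 & diag_block h b = jmx y.
    by have /imsetP[y] := hJ b; rewrite inE => y0 ->; exists y.
  exists y; first exact: y0.
  have dE : diag_block h = fun b => jmx (y b).
    exact: functional_extensionality_dep.
  rewrite /rows_mx -dE; exact: hE.
have dE : diag_block (rows_mx y) = fun b => jmx (y b).
  by apply: functional_extensionality_dep => b; exact: diag_blockK.
split; first by rewrite dE.
by apply/forallP => b; rewrite dE; apply/imsetP; exists (y b); rewrite ?inE.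
Qed.

Lemma iota_rows_mx (y : rows) : iota_tilde (rows_mx y) = row_iota y.
Proof.
have jE b : jcoef (diag_block (rows_mx y) b) = rcoef (y b).
  by apply: funext => j; rewrite diag_blockK jcoef_jmx // ns_gt0.
by congr (_, _); apply/ffunP => b; rewrite !ffunE jE.
Qed.

(** Injectivity of iota_tilde, from injectivity of the logarithm on each block; it ensures that each
    s is matched by a single h. *)
Lemma row_iota_inj (y y' : rows) : (forall b, rcoef (y b) 0 != 0) ->
  row_iota y = row_iota y' -> y = y'.
Proof.
move=> y0 [/ffunP E1 /ffunP E2]; apply: functional_extensionality_dep => b.
apply: rcoef_inj; apply: (theta_inj (m := part_size ns b)) => //.
- exact: unit_lt.
- exact: ns_gt0.
- by have := E1 b; rewrite !ffunE.
case=> // i lt_im; have lt_im1 : (i < (part_size ns b).-1)%N.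
  by rewrite ltn_predRL.
have := E2 (Tagged (fun b => 'I_(part_size ns b).-1) (Ordinal lt_im1)).
by rewrite !ffunE.
Qed.

Variables (C : numClosedFieldType) (psi : F -> C).

Definition rows_char (chi : Hchar F ns ps C) (y : rows) : C :=
  \prod_b row_char psi (chi b) (rcoef (y b)).

Lemma Hchar_rows_mx chi (y : rows) :
  Hchar_val psi chi (rows_mx y) = rows_char chi y.
Proof.
apply: eq_bigr => b _; rewrite /jchar_val /row_char diag_blockK.
rewrite (_ : jcoef _ = rcoef (y b)) //.
by apply: funext => j; rewrite jcoef_jmx // ns_gt0.
Qed.

(** Exchanging the sums over h and s leaves for each s the single h whose blocks have the first rows
    s z, if all first entries are nonzero, and no h otherwise. *)
Lemma N_DeltaE z (chi : Hchar F ns ps C) :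
  N_Delta psi e z chi =
  #|H_Delta F ns ps|%:R^-1 * #|unit_part|%:R *
    \sum_(s : 'rV[F]_d | [forall b, rcoef (sz z s b) 0 != 0])
       rows_char chi (sz z s).
Proof.
rewrite /N_Delta /twisted_count -mulrA; congr (_ * _).
transitivity (\sum_(h in H_Delta F ns ps)
    \sum_(s | row_iota (sz z s) == iota_tilde h)
    (#|unit_part|%:R * Hchar_val psi chi h)).
  apply: eq_bigr => h /H_DeltaP[y y0 ->]; rewrite /H_act iota_rows_mx.
  rewrite card_twisted_points => [|b]; last by rewrite ffunE.
  by rewrite -[RHS]big_set sumr_const natrM -[RHS]mulr_natr mulrCA mulrA.
rewrite (exchange_big_dep predT) //= mulr_sumr [RHS]big_mkcond.
apply: eq_bigr => s _.
case: forallP => [s0 | s0]; last first.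
  rewrite big_pred0 // => h; apply/negP => /andP[/H_DeltaP[y y0 ->]].
  rewrite iota_rows_mx => /eqP[/ffunP E1 _]; case: s0 => b.
  by have := E1 b; rewrite !ffunE => ->.
rewrite (big_pred1 (rows_mx (sz z s))) ?Hchar_rows_mx // => h.
apply/andP/eqP => [[/H_DeltaP[y y0 ->]] | ->].
  by rewrite iota_rows_mx => /eqP/(row_iota_inj s0) ->.
by rewrite iota_rows_mx; split=> //; apply/H_DeltaP; exists (sz z s).
Qed.

End Counting.

(** * The three transformation rules *)

Section Symmetries.
Variables (F : finFieldType) (K : closedFieldType) (e : {rmorphism F -> K}).
Variables (k : nat) (ns ps : 'I_k -> nat) (d : nat).
Variables (C : numClosedFieldType) (psi : F -> C).
Hypothesis psi_char : additive_character psi.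
Hypothesis ns_gt0 : forall i, (0 < ns i)%N.
Hypothesis unit_lt : forall i r, (0 < r < ns i)%N -> r%:R != 0 :> F.
Implicit Types (z : 'M[F]_(d, psum ns ps)) (chi : Hchar F ns ps C).

(** The substitution s -> s g permutes F^d. *)
Lemma N_Delta_GL (g : 'M[F]_d) z chi : g \in unitmx ->
  N_Delta psi e z chi = N_Delta psi e (g *m z) chi.
Proof.
move=> gU; rewrite !N_DeltaE //; congr (_ * _).
have szE s b : sz (g *m z) s b = sz z (s *m g) b.
  by rewrite /sz zblock_mull mulmxA.
rewrite (reindex (fun s : 'rV[F]_d => s *m g)); last first.
  by exists (fun s => s *m invmx g) => s _; rewrite ?mulmxK ?mulmxKV.
apply: eq_big => [s | s _]; first by apply: eq_forallb => b; rewrite szE.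
by apply: eq_bigr => b _; rewrite szE.
Qed.

(** Right multiplication by h scales first entries by units, so the same s contribute, each term
    gaining the factor chi(h). *)
Lemma N_Delta_H h z chi : h \in H_Delta F ns ps ->
  Hchar_val psi chi h * N_Delta psi e z chi = N_Delta psi e (z *m h) chi.
Proof.
case/H_DeltaP => y y0 ->; rewrite Hchar_rows_mx // !N_DeltaE // mulrCA.
congr (_ * _); rewrite mulr_sumr.
have szE s b : sz (z *m rows_mx y) s b = sz z s b *m jmx (y b).
  by rewrite /sz zblock_block_diag mulmxA.
apply: eq_big => [s | s /forallP s0].
  apply: eq_forallb => b; rewrite szE rcoef_mul_jmx ?ns_gt0 // big_ord1.
  by rewrite mulf_eq0 (negPf (y0 b)) orbF.
rewrite -big_split; apply: eq_bigr => b _ /=.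
by rewrite szE row_char_mul ?ns_gt0 // 1?mulrC //; apply: unit_lt.
Qed.

Lemma W_index_bij (w : W_Delta F ns ps) : bijective (W_index w).
Proof.
exists (fun b => Tagged (fun i => 'I_(ps i))
                   ((W_perm w (tag b))^-1%g (tagged b))) => -[i j].
  by rewrite /W_index /= permK.
by rewrite /W_index /= permKV.
Qed.

Lemma rcoef_sz_W w z (s : 'rV[F]_d) b :
  rcoef (sz (z *m W_mx w) s b) 0 = rcoef (sz z s (W_index w b)) 0.
Proof.
case: b => i j; rewrite /sz zblock_W_mx mulmxA; apply: rcoef_mul_mu0.
exact: ns_gt0.
Qed.

Lemma row_char_sz_W w z chi (s : 'rV[F]_d) b :
  rcoef (sz z s (W_index w b)) 0 != 0 ->
  row_char psi (Hchar_tw chi w (W_index w b)) (rcoef (sz z s (W_index w b))) =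
  row_char psi (chi b) (rcoef (sz (z *m W_mx w) s b)).
Proof.
case: b => i j s0; rewrite /sz zblock_W_mx mulmxA /Hchar_tw /= permK.
symmetry; apply: row_char_mu => //; first exact: ns_gt0.
exact: unit_lt.
Qed.

(** For each s the product over parts is reindexed along sigma; component sigma(j) of the
    transformed character involves chi_j, which pairs with block j of z w. *)
Lemma N_Delta_W (w : W_Delta F ns ps) z chi :
  N_Delta psi e z (Hchar_tw chi w) = N_Delta psi e (z *m W_mx w) chi.
Proof.
rewrite !N_DeltaE //; congr (_ * _).
have [W' _ WK'] := W_index_bij w.
apply: eq_big => [s | s /forallP s0].
  apply/forallP/forallP => s0 b; first by rewrite rcoef_sz_W.
  by rewrite -(WK' b) -rcoef_sz_W.
rewrite /rows_char (reindex (W_index w)); last exact/onW_bij/W_index_bij.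
by apply: eq_bigr => b _; rewrite row_char_sz_W.
Qed.

End Symmetries.

Theorem theorem5p5 (F : finFieldType) (p : nat) (hp : p \in [pchar F])
  (* an algebraic closure of F *)
  (K : closedFieldType) (e : {rmorphism F -> K}) (he : integralRange e)
  (C : numClosedFieldType) (psi : F -> C)
  (hpsi : additive_character psi) (hpsi1 : exists x, psi x != 1)
  (k : nat) (ns ps : 'I_k -> nat)
  (hns_pos : forall i, (0 < ns i)%N) (hps_pos : forall i, (0 < ps i)%N)
  (hns_lt : forall i j : 'I_k, (i < j)%N -> (ns i < ns j)%N)
  (hns_le : forall i, (ns i <= p)%N)
  (d : nat) (z : 'M[F]_(d, psum ns ps)) (chi : Hchar F ns ps C) :
  [/\ forall g : 'M[F]_d, g \in unitmx ->
        N_Delta psi e z chi = N_Delta psi e (g *m z) chi,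
      forall h : 'M[F]_(psum ns ps), h \in H_Delta F ns ps ->
        Hchar_val psi chi h * N_Delta psi e z chi = N_Delta psi e (z *m h) chi
    & forall w : W_Delta F ns ps,
        N_Delta psi e z (Hchar_tw chi w) = N_Delta psi e (z *m W_mx w) chi].
Proof.
(* The bound n_i <= p enters here: p does not divide r when 0 < r < p. *)
have unit_lt i r : (0 < r < ns i)%N -> r%:R != 0 :> F.
  move=> /andP[r_gt0 lt_rn]; rewrite -(dvdn_pcharf hp).
  by rewrite gtnNdvd // (leq_trans lt_rn).
split=> [g gU | h hH | w].
- exact: N_Delta_GL.
- exact: N_Delta_H.
- exact: N_Delta_W.
Qed.
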